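(* Let $m>2$ be an integer and let $P_{-2,n}(c)$, $n\ge0$, be the polynomials in $c$ defined by $P_{-2,0}=P_{-2,1}=P_{-2,3}=0$, $P_{-2,2}=1$ and $$(km+m+4)\,P_{-2,k+4}(c)=2c\,(km-m+2)\,P_{-2,k+2}(c)-(km-3m)\,P_{-2,k}(c),\qquad k\ge0 .$$ Then the polynomials $\overline q_n:=P_{-2,2n+2}$, $n\ge0$ (where $\overline q_n$ has degree $n$), are orthogonal with respect to some weight measure.
   Context: Orthogonality of a sequence $\{p_n\}_{n\ge0}$ of real polynomials with $\deg p_n=n$ with respect to a weight measure means: there is a positive Borel measure $\mu$ on $\mathbb{R}$ with finite moments such that $\int p_ip_j\,d\mu=0$ for $i\neq j$ and $\int p_i^2\,d\mu>0$ for all $i$. All $P_{-2,n}$ with $n$ odd vanish, as does $P_{-2,0}$. *)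

(* Defs.v *)
From mathcomp Require Import all_boot all_order all_algebra.
From mathcomp Require Import all_classical all_reals all_analysis.
Set Implicit Arguments.
Unset Strict Implicit.
Unset Printing Implicit Defensive.
Import Order.TTheory GRing.Theory Num.Theory.
Local Open Scope ring_scope.

(* [measurableTypeR R] is R with its Borel sigma-algebra.  Finiteness of the
   0-th moment makes mu a finite measure. *)
Definition finite_moments (R : realType)
    (mu : {measure set (measurableTypeR R) -> \bar R}) : Prop :=
  forall k : nat, mu.-integrable [set: R] (fun x : R => (x ^+ k)%:E).

(* [size p = n.+1] says that p has degree exactly n.  With finite moments all
   the products of polynomials below are integrable, so the (total)
   extended-real integrals have their usual meaning. *)
Definition orthogonal_polynomials (R : realType) (p : nat -> {poly R}) : Prop :=
  (forall n : nat, size (p n) = n.+1) /\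
  exists mu : {measure set (measurableTypeR R) -> \bar R},
    [/\ finite_moments mu,
        forall i j : nat, i <> j ->
          (\int[mu]_(x in [set: R]) ((p i).[x] * (p j).[x])%:E = 0)%E
      & forall i : nat,
          (0 < \int[mu]_(x in [set: R]) ((p i).[x] ^+ 2)%:E)%E].

(* Main.v *)
Require Import Defs.
From HB Require Import structures.
From mathcomp Require Import all_boot all_order all_algebra.
From mathcomp Require Import all_classical all_reals all_analysis.
From mathcomp Require Import measurable_realfun ring lra zify.
Set Implicit Arguments.
Unset Strict Implicit.
Unset Printing Implicit Defensive.
Import Order.TTheory GRing.Theory Num.Theory.
Import numFieldNormedType.Exports.
Local Open Scope ring_scope.

(** The even-indexed part of the recurrence reads
      x q_n = a_n q_{n+1} + c_{n-1} q_{n-1}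
    with a_n c_n > 0 for all n (both signs are negative for n = 0 because
    m > 2) and |a_n|, |c_n| <= 4, so this is an instance of Favard's theorem
    with bounded coefficients.

    Multiplication by x acts on coordinates in the basis (q_n) as a Jacobi
    operator, which is symmetric for a weighted inner product; the functional
    L p = "coefficient of q_0 in p" then satisfies L (p q) = <p, q>, and the
    bound on the coefficients gives |L (p^2 x)| <= A L (p^2) with A = 8.  After
    an affine change of variable sending [-A, A] to [0, 1], L is nonnegative on
    every x^i (1 - x)^j, and it remains to solve a Hausdorff moment problem.

    The numbers L (C(n,j) x^j (1 - x)^(n-j)) are the weights of probability
    measures on {0, 1/n, ..., 1} whose moments tend to those of L.  Their
    quantile functions are monotone with values in [0, 1]; a pointwise limit Y
    along an ultrafilter is again monotone.  Averages of a monotone function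
    over the points i/M differ from its mean by at most 1/M, uniformly, so the
    moments pass to the limit and the law of Y under the uniform probability
    represents L. *)

(** * Linear functionals on polynomials with prescribed moments *)

Section MomentFunctional.
Variable R : realFieldType.
Implicit Types (s : nat -> R) (p q : {poly R}).

Definition moment_functional s p : R := \sum_(k < size p) p`_k * s k.

Lemma moment_functional_widen s p N : (size p <= N)%N ->
  moment_functional s p = \sum_(k < N) p`_k * s k.
Proof.
move=> pN; rewrite -(subnKC pN) big_split_ord /= [X in _ + X]big1 ?addr0 //.
by move=> k _; rewrite nth_default ?mul0r // leq_addr.
Qed.

Lemma moment_functional_is_linear s : scalar (moment_functional s).
Proof.
move=> r p q; pose N := (size (r *: p + q)%R + size p + size q)%N.
rewrite !(@moment_functional_widen s _ N) ?/N; try lia.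
rewrite mulr_sumr -big_split; apply: eq_bigr => k _ /=.
by rewrite coefD coefZ mulrDl mulrA.
Qed.
HB.instance Definition _ s := GRing.isLinear.Build R {poly R} R _
  (moment_functional s) (moment_functional_is_linear s).

Lemma moment_functional1 s : moment_functional s 1 = s 0%N.
Proof. by rewrite /moment_functional size_poly1 big_ord1 coefC mul1r. Qed.

Lemma moment_functionalXM s p :
  moment_functional s ('X * p) = moment_functional (s \o succn) p.
Proof.
rewrite mulrC (@moment_functional_widen s _ (size p).+1) ?size_polyMXleq //.
  rewrite big_ord_recl coefMX mul0r add0r.
  by apply: eq_bigr => k _; rewrite coefMX.
by have [->|/size_mulX ->] := eqVneq p 0; rewrite ?mul0r ?size_poly0.
Qed.

End MomentFunctional.

(** * Jacobi operators *)

Section Jacobi.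
Variables (R : realFieldType) (a c : nat -> R).
Implicit Types (p q : {poly R}) (u v : nat -> R).

(* The action of multiplication by 'X on coordinates with respect to a family
   such that 'X q_n.+1 = a n.+1 q_n.+2 + c n q_n; so [c n] is attached to q_n. *)
Definition jacobi u : nat -> R :=
  fun n => (if n is k.+1 then a k * u k else 0) + c n * u n.+1.

(** The coordinates of ['X^k] when [q_0 = 1], as a Krylov sequence of the operator. *)
Definition krylov k : nat -> R := iter k jacobi (fun n => (n == 0)%:R).

(* For a family satisfying the recurrence, [coords p n] is the coefficient of
   q_n in p (see [coords_recurrence]), but it makes sense without it. *)
Definition coords p n := moment_functional (krylov^~ n) p.

Lemma coordsP r p q n : coords (r *: p + q) n = r * coords p n + coords q n.
Proof. by rewrite /coords linearP. Qed.

Lemma coordsZ r p n : coords (r *: p) n = r * coords p n.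
Proof. by rewrite /coords linearZ. Qed.

Lemma coords1 n : coords 1 n = (n == 0)%:R.
Proof. by rewrite /coords moment_functional1. Qed.

Lemma coordsXM p n : coords ('X * p) n = jacobi (coords p) n.
Proof.
rewrite /coords moment_functionalXM /moment_functional /jacobi mulr_sumr.
case: n => [|n]; rewrite ?mulr_sumr ?add0r -?big_split;
  apply: eq_bigr => k _; rewrite /= /jacobi; ring.
Qed.

(** Each application of [jacobi] raises the top index of the support by at most one. *)
Lemma krylov_gt k n : (k < n)%N -> krylov k n = 0.
Proof.
elim: k n => [|k IHk] [|n] //= kn; rewrite -/(krylov k) /jacobi.
by rewrite !IHk ?mulr0 ?addr0 //; lia.
Qed.

Lemma coords_size p n : (size p <= n)%N -> coords p n = 0.
Proof.
move=> pn; apply: big1 => k _; rewrite krylov_gt ?mulr0 //.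
exact: leq_trans (ltn_ord k) pn.
Qed.

Variable q_ : nat -> {poly R}.
Hypotheses (q0 : q_ 0 = 1) (q1 : 'X * q_ 0 = a 0%N *: q_ 1).
Hypothesis qS : forall n, 'X * q_ n.+1 = a n.+1 *: q_ n.+2 + c n *: q_ n.
Hypothesis ac_gt0 : forall n, 0 < a n * c n.

Lemma jacobi_a_neq0 n : a n != 0.
Proof. by apply/eqP => an0; have := ac_gt0 n; rewrite an0 mul0r ltxx. Qed.

(** Since [a n.+1] is nonzero, the leading term of [q_ n.+2] comes from ['X * q_ n.+1]. The
    three-term recurrence requires carrying two consecutive indices through the induction. *)
Lemma size_recurrence n : size (q_ n) = n.+1.
Proof.
suff [] : size (q_ n) = n.+1 /\ size (q_ n.+1) = n.+2 by [].
have scal k p : size (a k *: p) = size p by rewrite size_scale ?jacobi_a_neq0.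
have sX p m : size p = m.+1 -> size ('X * p) = m.+2.
  by move=> pm; rewrite mulrC size_mulX ?pm // -size_poly_eq0 pm.
elim: n => [|n [IH1 IH2]].
  by rewrite q0 size_poly1 -(scal 0%N) -q1 (@sX _ 0%N) // q0 size_poly1.
split=> //; rewrite -(scal n.+1) -[a _ *: _](addrK (c n *: q_ n)) -qS.
rewrite size_polyDl (sX _ _ IH2) // size_polyN ltnS.
by apply: leq_trans (size_scale_leq _ _) _; rewrite IH1.
Qed.

(** Two-step induction again: solve the recurrence for its leading member. Applying [jacobi] to the
    unit vector at [k.+1] gives [a k.+1] at [k.+2] and [c k] at [k], and the latter is cancelled by
    [c k *: q_ k]. *)
Lemma coords_recurrence k n : coords (q_ k) n = (n == k)%:R.
Proof.
suff [] : (forall n, coords (q_ k) n = (n == k)%:R) /\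
    (forall n, coords (q_ k.+1) n = (n == k.+1)%:R) by [].
elim: k {n} => [|k [IH1 IH2]].
  split=> n; first by rewrite q0 coords1.
  apply: (mulfI (jacobi_a_neq0 0)).
  rewrite -coordsZ -q1 coordsXM /jacobi q0 !coords1 mulr0 addr0.
  case: n => [|n]; rewrite ?mulr0 // coords1.
  by case: n => [|n]; rewrite ?mulr1 ?mulr0.
split=> // n; apply: (mulfI (jacobi_a_neq0 k.+1)).
rewrite -coordsZ -[a _ *: _](addrK (c k *: q_ k)) -qS addrC -scaleNr coordsP.
rewrite coordsXM /jacobi IH1 !IH2.
case: n => [|n]; rewrite ?IH2 !eqSS /=.
  by case: (altP (0%N =P k)) => [<-|_] /=; ring.
case: (altP (n.+1 =P k)) => [<-|_].
  have /negPf-> : n != n.+2 by lia.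
  by rewrite /=; ring.
by case: (altP (n =P k.+1)) => [->|_] /=; ring.
Qed.

(* The squared norm of q_n, forced by the symmetry a_n h_{n+1} = c_n h_n. *)
Fixpoint jacobi_weight n : R :=
  if n is k.+1 then jacobi_weight k * (c k / a k) else 1.
Local Notation h := jacobi_weight.

Lemma jacobi_weight_gt0 n : 0 < h n.
Proof.
elim: n => //= n IHn; rewrite mulr_gt0 //.
have -> : c n / a n = (a n * c n) / (a n) ^+ 2.
  by have := jacobi_a_neq0 n => an0; field.
by rewrite divr_gt0 // exprn_even_gt0 ?jacobi_a_neq0.
Qed.

Lemma jacobi_weightS n : a n * h n.+1 = c n * h n.
Proof. by rewrite /=; field; exact: jacobi_a_neq0. Qed.

(** Truncated at [N] to avoid infinite sums; for coordinates of polynomials a large enough [N] loses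
    nothing. *)
Definition jacobi_dot N u v := \sum_(n < N) h n * (u n * v n).

(** By [jacobi_weightS] the two off-diagonal entries carry the same weight, so the result is
    symmetric in [u] and [v]. The condition [u M.+1 = 0] removes the one term that reaches beyond
    the truncation. *)
Lemma jacobi_dotE M u v : u M.+1 = 0 ->
  jacobi_dot M.+1 (jacobi u) v =
  \sum_(n < M) c n * h n * (u n * v n.+1 + u n.+1 * v n).
Proof.
move=> uM; rewrite /jacobi_dot /jacobi.
under eq_bigr do rewrite mulrDl mulrDr.
rewrite big_split big_ord_recl big_ord_recr /= uM mulr0 !mul0r !mulr0 add0r addr0.
rewrite -big_split; apply: eq_bigr => n _ /=.
rewrite add0n -[h n * (c n / a n)]/(h n.+1).
have -> : h n.+1 * (a n * u n * v n.+1) = a n * h n.+1 * (u n * v n.+1) by ring.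
by rewrite jacobi_weightS; ring.
Qed.

Lemma jacobi_dotC M u v : u M.+1 = 0 -> v M.+1 = 0 ->
  jacobi_dot M.+1 (jacobi u) v = jacobi_dot M.+1 u (jacobi v).
Proof.
move=> uM vM; transitivity (jacobi_dot M.+1 (jacobi v) u).
  by rewrite !jacobi_dotE //; apply: eq_bigr => n _; ring.
by apply: eq_bigr => n _; ring.
Qed.

(* Both |a n| h n.+1 and |c n| h n equal the off-diagonal weight, which is
   therefore at most K times each of h n and h n.+1; then use 2xy <= x^2 + y^2. *)
Lemma jacobi_dot_bound K M u : (forall n, `|a n| <= K) ->
    (forall n, `|c n| <= K) -> u M.+1 = 0 ->
  `|jacobi_dot M.+1 (jacobi u) u| <= 2 * K * jacobi_dot M.+1 u u.
Proof.
move=> aK cK uM; rewrite jacobi_dotE //.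
have K0 : 0 <= K := le_trans (normr_ge0 _) (aK 0%N).
have t_ge0 n : 0 <= h n * (u n * u n).
  by rewrite mulr_ge0 ?(ltW (jacobi_weight_gt0 n)) // -expr2 sqr_ge0.
apply: (@le_trans _ _ (\sum_(n < M) (K * (h n * (u n * u n)) +
    K * (h n.+1 * (u n.+1 * u n.+1))))); last first.
  rewrite big_split /= -!mulr_sumr [2 * K]mulr_natl mulr2n mulrDl.
  apply: lerD; apply: ler_wpM2l => //; rewrite /jacobi_dot.
    by rewrite big_ord_recr lerDl.
  by rewrite big_ord_recl lerDr t_ge0.
apply: le_trans (ler_norm_sum _ _ _) (ler_sum _ _) => n _.
set x := u n; set y := u n.+1.
have -> : x * y + y * x = 2 * (x * y) by ring.
rewrite !(normrM, ger0_norm (ler0n R 2)) -normrM.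
have h1 := jacobi_weight_gt0 n; have h2 := jacobi_weight_gt0 n.+1.
set w := `|c n * h n|.
have w1 : w <= K * h n by rewrite /w normrM (gtr0_norm h1) ler_wpM2r // ltW.
have w2 : w <= K * h n.+1.
  by rewrite /w -jacobi_weightS normrM (gtr0_norm h2) ler_wpM2r // ltW.
apply: (@le_trans _ _ (w * (x * x) + w * (y * y))).
  rewrite -mulrDr ler_wpM2l ?normr_ge0 //.
  have := sqr_ge0 (`|x| - `|y|); rewrite sqrrB !real_normK ?num_real // !expr2.
  by rewrite -mulr_natl; lra.
by apply: lerD; rewrite [K * _]mulrA ler_wpM2r // -expr2 sqr_ge0.
Qed.

(** Induction on [p]: the symmetry [jacobi_dotC] lets a factor ['X] move from [p] to [q], and
    constants only see the coordinate of index 0. *)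
Lemma coords0M p q N : (size p + size q < N)%N ->
  coords (p * q) 0 = jacobi_dot N (coords p) (coords q).
Proof.
elim/poly_ind: p q N => [|p r IHp] q N.
  rewrite mul0r => _; rewrite /jacobi_dot big1 => [|n _].
    by rewrite coords_size // size_poly0.
  by rewrite [coords 0 n]coords_size ?size_poly0 // mul0r mulr0.
case: N => // N pqN.
have -> : (p * 'X + r%:P) * q = r *: q + p * ('X * q).
  by rewrite -mul_polyC; ring.
have sq : (size q <= N)%N by lia.
have [p0|p0] := eqVneq p 0.
  rewrite p0 !mul0r add0r addr0 coordsZ /jacobi_dot.
  rewrite (bigD1 ord0) //= big1 => [|n n0].
    by rewrite -alg_polyC coordsZ coords1 /=; ring.
  rewrite -alg_polyC coordsZ coords1.
  have /negPf-> : (n : nat) != 0%N by move: n0; rewrite -val_eqE.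
  by rewrite mulr0 mul0r mulr0.
have sX : (size ('X * q)%R <= (size q).+1)%N.
  by rewrite mulrC; apply: leq_trans (size_polyMleq _ _) _; rewrite size_polyX; lia.
have sp : size (p * 'X + r%:P) = (size p).+1 by rewrite size_MXaddC (negPf p0).
rewrite sp in pqN.
have Hp : (size p <= N.+1)%N by lia.
have Hq : (size q <= N.+1)%N by lia.
rewrite coordsP (IHp _ N.+1); last by lia.
have := @jacobi_dotC N (coords p) (coords q) (coords_size Hp) (coords_size Hq).
have -> : jacobi_dot N.+1 (coords p) (coords ('X * q)) =
          jacobi_dot N.+1 (coords p) (jacobi (coords q)).
  by apply: eq_bigr => n _; rewrite coordsXM.
move=> <-.
have -> : r * coords q 0 =
    jacobi_dot N.+1 (fun n => r * (n == 0)%:R) (coords q).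
  rewrite /jacobi_dot big_ord_recl big1 => [|n _] /=; first by ring.
  by rewrite mulr0 mul0r mulr0.
rewrite /jacobi_dot -big_split; apply: eq_bigr => n _ /=.
rewrite -alg_polyC [p * 'X]mulrC ['X * p + _]addrC coordsP coords1 coordsXM.
ring.
Qed.

Lemma coords0_sqr_ge0 p : 0 <= coords (p ^+ 2) 0.
Proof.
rewrite expr2 (@coords0M _ _ (size p + size p).+1) // sumr_ge0 // => n _.
by rewrite mulr_ge0 ?(ltW (jacobi_weight_gt0 n)) // -expr2 sqr_ge0.
Qed.

(** Equivalently, [2 * K - 'X] and [2 * K + 'X] are nonnegative against squares, so a representing
    measure may be sought on [[-2K, 2K]]. *)
Lemma coords0_sqrX_bound K p : (forall n, `|a n| <= K) ->
    (forall n, `|c n| <= K) ->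
  `|coords (p ^+ 2 * 'X) 0| <= 2 * K * coords (p ^+ 2) 0.
Proof.
move=> aK cK; have -> : p ^+ 2 * 'X = 'X * p * p by ring.
have sX : (size ('X * p)%R <= (size p).+1)%N.
  by rewrite mulrC; apply: leq_trans (size_polyMleq _ _) _; rewrite size_polyX; lia.
pose N := (size p + size p).+1.
rewrite expr2 !(@coords0M _ _ N.+1); try by lia.
have -> : jacobi_dot N.+1 (coords ('X * p)) (coords p) =
          jacobi_dot N.+1 (jacobi (coords p)) (coords p).
  by apply: eq_bigr => n _; rewrite coordsXM.
by apply: jacobi_dot_bound => //; apply: coords_size; lia.
Qed.

Lemma coords0_recurrence i j : coords (q_ i * q_ j) 0 = h i *+ (i == j).
Proof.
rewrite (@coords0M _ _ (i.+1 + j.+1).+1); last by rewrite !size_recurrence.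
have iN : (i < (i.+1 + j.+1).+1)%N by lia.
rewrite /jacobi_dot (bigD1 (Ordinal iN)) //= big1 => [|n].
  by rewrite !coords_recurrence eqxx /= addr0 mul1r mulr_natr.
by rewrite -val_eqE /= !coords_recurrence => /negPf->; rewrite mul0r mulr0.
Qed.

End Jacobi.

(** * Bernstein weights and their quantile functions *)

Lemma telescope_sum_ord (V : zmodType) (f : nat -> V) n :
  \sum_(j < n) (f j.+1 - f j) = f n - f 0%N.
Proof.
by rewrite -(big_mkord xpredT (fun j => f j.+1 - f j)) telescope_sumr.
Qed.

(** Multiplied by [k! i! (m - i)!], both sides become [(k + m)!]. *)
Lemma bin_trinomial k m i : (i <= m)%N ->
  ('C(k + m, k + i) * 'C(k + i, k) = 'C(k + m, k) * 'C(m, i))%N.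
Proof.
move=> im; have F : (0 < k`! * i`! * (m - i)`!)%N by rewrite !muln_gt0 !fact_gt0.
apply/eqP; rewrite -(eqn_pmul2r F); apply/eqP.
have E1 : ('C(k + m, k + i) * ((k + i)`! * (m - i)`!) = (k + m)`!)%N.
  by rewrite -(subnDl k m i) bin_fact ?leq_add2l.
have E2 := bin_fact (leq_addr i k); have E3 := bin_fact (leq_addr m k).
have E4 := bin_fact im; rewrite addKn in E2; rewrite addKn in E3.
transitivity ((k + m)`!); [rewrite -E1 -E2 | rewrite -E3 -E4]; ring.
Qed.

Section Bernstein.
Variable R : realFieldType.

Definition bernstein n j : {poly R} := 'C(n, j)%:R *: ('X^j * (1 - 'X) ^+ (n - j)).

(** These are the factorial moments of the binomial law: the terms with [j < k] vanish, and the
    others expand ['X^k * (1 - 'X + 'X) ^+ (n - k)]. *)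
Lemma sum_bin_bernstein n k : (k <= n)%N ->
  \sum_(j < n.+1) 'C(j, k)%:R *: bernstein n j = 'C(n, k)%:R *: 'X^k.
Proof.
move=> kn; rewrite -(subnKC kn); set m := (n - k)%N; rewrite -addnS big_split_ord /=.
rewrite big1 ?add0r => [|i _]; last by rewrite bin_small ?scale0r.
have -> : 'X^k = \sum_(i < m.+1) 'C(m, i)%:R *: ('X^(k + i) * (1 - 'X) ^+ (m - i)) :> {poly R}.
  have <- : 'X^k * (1 - 'X + 'X) ^+ m = 'X^k :> {poly R} by rewrite subrK expr1n mulr1.
  rewrite exprDn mulr_sumr.
  by apply: eq_bigr => i _; rewrite mulrnAr scaler_nat exprD mulrCA mulrC.
rewrite scaler_sumr; apply: eq_bigr => i _.
rewrite /bernstein !scalerA -!natrM subnDl mulnC bin_trinomial //.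
by rewrite -ltnS.
Qed.

End Bernstein.

(** * Quantile functions of finitely supported laws and their Riemann sums *)

Section QuantileSums.
Variable R : realFieldType.

(** The indices satisfying [b] form an initial segment, along which the increments of [g]
    telescope. *)
Lemma count_down_closed (b : nat -> bool) (g : nat -> R) n :
    (forall j, b j.+1 -> b j) ->
  g (\sum_(j < n) b j)%N = g 0%N + \sum_(j < n) (g j.+1 - g j) * (b j)%:R.
Proof.
move=> bS; elim: n => [|n IHn]; first by rewrite !big_ord0 addr0.
rewrite !big_ord_recr /=; case: (boolP (b n)) => bn; last first.
  by rewrite addn0 IHn mulr0 addr0.
have ball k : b k -> forall j, (j <= k)%N -> b j.
  elim: k => [|k IHk] bk j; first by rewrite leqn0 => /eqP->.
  by rewrite leq_eqVlt ltnS => /orP[/eqP->//|]; apply/IHk/bS.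
have sn : (\sum_(j < n) b j)%N = n.
  rewrite (eq_bigr (fun=> 1%N)) => [|j _]; first by rewrite sum1_card card_ord.
  by rewrite (ball n bn) // ltnW.
by rewrite sn in IHn *; rewrite addn1 mulr1; lra.
Qed.

(** Abel summation, written with the tails of [w]. *)
Lemma sum_parts (w g : nat -> R) n :
  \sum_(j < n.+1) w j * g j = g 0%N * \sum_(j < n.+1) w j +
    \sum_(j < n) (g j.+1 - g j) * (\sum_(i < n.+1) w i - \sum_(i < j.+1) w i).
Proof.
elim: n => [|n IHn]; first by rewrite big_ord0 addr0 !big_ord1 mulrC.
rewrite big_ord_recr /= IHn [\sum_(j < n.+2) w j]big_ord_recr /=.
rewrite [\sum_(j < n.+1) (g _ - g _) * _]big_ord_recr /=.
set S := \sum_(j < n.+1) w j.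
have -> : \sum_(j < n) (g j.+1 - g j) * (S + w n.+1 - \sum_(i < j.+1) w i) =
    \sum_(j < n) (g j.+1 - g j) * (S - \sum_(i < j.+1) w i) +
    (g n - g 0%N) * w n.+1.
  by rewrite -telescope_sum_ord mulr_suml -big_split; apply: eq_bigr => j _ /=; ring.
by ring.
Qed.

(** The sum counts the integers in [[x, M)], an interval of length [M - x]. Each one-sided bound is
    proved by induction for every [N]; the maximum with 0 covers [N < x]. *)
Lemma count_ge_bound (x : R) M : 0 <= x <= M%:R ->
  `|(M%:R - x) - \sum_(i < M) (x <= i%:R)%R%:R| <= 1.
Proof.
move=> /andP[x0 xM]; pose S M : R := \sum_(i < M) (x <= i%:R)%R%:R.
have lo N : N%:R - x - 1 <= S N.
  elim: N => [|N IHN]; rewrite /S ?big_ord0 ?big_ord_recr /= -?/(S N).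
    lra.
  have SN0 : 0 <= S N by exact: sumr_ge0.
  by rewrite -natr1; case: (lerP x N%:R) => /= xN; rewrite ?addr0; lra.
have hi N : S N <= Num.max 0 (N%:R - x).
  elim: N => [|N IHN]; rewrite /S ?big_ord0 ?le_max ?lexx // big_ord_recr -/(S N) /=.
  rewrite -natr1; case: (lerP x N%:R) => /= xN; apply/orP; move: IHN.
    by rewrite maxEle subr_ge0 xN => IHN; right; lra.
  by rewrite maxEle subr_ge0 (lt_geF xN) => IHN; left; rewrite addr0.
have := lo M; have := hi M; rewrite -/(S M) maxEle subr_ge0 xM => h1 h2.
by rewrite ler_norml; apply/andP; split; lra.
Qed.

Variables (w : nat -> R) (n : nat).
Hypotheses (w_ge0 : forall j, 0 <= w j) (w_sum : \sum_(j < n.+1) w j = 1).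

(** With this strict bound, the distribution function at [j] is [cumul j.+1]. *)
Definition cumul j := \sum_(i < j) w i.

(* For t >= 0 and w nonnegative, the largest j <= n with [cumul j <= t]. *)
Definition quantile t := (\sum_(j < n) (cumul j.+1 <= t)%R)%N.

Lemma cumul_ge0 j : 0 <= cumul j.
Proof. exact: sumr_ge0. Qed.

Lemma cumul_le1 j : (j <= n)%N -> cumul j.+1 <= 1.
Proof.
move=> jn; rewrite -w_sum /cumul -(subnKC jn) -addSn big_split_ord /=.
by rewrite lerDl sumr_ge0.
Qed.

Lemma quantile_le t : (quantile t <= n)%N.
Proof.
rewrite -[leqRHS]card_ord -sum1_card /quantile; apply: leq_sum => j _.
exact: leq_b1.
Qed.

Lemma quantile_homo s t : s <= t -> (quantile s <= quantile t)%N.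
Proof.
move=> st; apply: leq_sum => j _; case: (lerP (cumul j.+1) s) => //= js.
by rewrite (le_trans js st).
Qed.

(* Abel summation on both sides reduces the estimate to the proportion of the
   points i / M lying above a given threshold. *)
Lemma quantile_riemann_sum (g : nat -> R) M : (0 < M)%N ->
    (forall j, g j <= g j.+1) ->
  `|\sum_(j < n.+1) w j * g j - M%:R^-1 * \sum_(i < M) g (quantile (i%:R / M%:R))|
  <= (g n - g 0%N) / M%:R.
Proof.
move=> M0 g_homo; have M0R : 0 < M%:R :> R by rewrite ltr0n.
rewrite sum_parts w_sum mulr1.
under [X in _ * X]eq_bigr => i _.
  rewrite /quantile (@count_down_closed (fun j => cumul j.+1 <= i%:R / M%:R)); last first.
    move=> j; apply: le_trans; rewrite /cumul [leRHS]big_ord_recr /=.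
    by rewrite lerDl.
  over.
rewrite big_split /= sumr_const card_ord exchange_big /= mulrDr.
rewrite -[g 0%N *+ M]mulr_natl mulKf ?gt_eqF // opprD addrACA subrr add0r.
rewrite mulr_sumr -sumrB -telescope_sum_ord mulr_suml.
apply: le_trans (ler_norm_sum _ _ _) (ler_sum _ _) => j _.
rewrite -mulr_sumr mulrCA -mulrBr normrM ger0_norm ?subr_ge0 //.
apply: ler_wpM2l; first by rewrite subr_ge0.
have jn : (j <= n)%N by exact: ltnW.
have := @count_ge_bound (cumul j.+1 * M%:R) M.
rewrite mulr_ge0 ?cumul_ge0 ?ler0n //= ler_piMl ?cumul_le1 ?ler0n //.
have Mi_ge0 : 0 <= M%:R^-1 :> R by rewrite invr_ge0.
move=> /(_ isT)/(ler_wpM2r Mi_ge0); rewrite mul1r; apply: le_trans.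
rewrite -[X in _ <= _ * X](ger0_norm Mi_ge0) -normrM.
rewrite le_eqVlt; apply/orP; left; apply/eqP; congr `|_|.
rewrite mulrBl mulrBl mulfK ?gt_eqF // divff ?gt_eqF // [in RHS]mulrC.
congr (_ - _ * _); apply: eq_bigr => i _; by rewrite ler_pdivlMr.
Qed.

End QuantileSums.

(** * Approximation of a functional by its Bernstein weights *)

Section HausdorffApprox.
Variables (R : realFieldType) (L : {scalar {poly R}}).
Hypotheses (L1 : L 1 = 1) (L_ge0 : forall i j, 0 <= L ('X^i * (1 - 'X) ^+ j)).

Definition bernstein_weight n j := L (bernstein R n j).

Lemma bernstein_weight_ge0 n j : 0 <= bernstein_weight n j.
Proof. by rewrite /bernstein_weight linearZ mulr_ge0. Qed.

Lemma sum_bernstein_weight n k : (k <= n)%N ->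
  \sum_(j < n.+1) bernstein_weight n j * 'C(j, k)%:R = 'C(n, k)%:R * L 'X^k.
Proof.
move=> kn; rewrite -[RHS]linearZ /= -(sum_bin_bernstein R kn) linear_sum /=.
by apply: eq_bigr => j _; rewrite linearZ /= mulrC.
Qed.

Lemma bernstein_weight_sum1 n : \sum_(j < n.+1) bernstein_weight n j = 1.
Proof.
have := @sum_bernstein_weight n 0 isT.
by rewrite bin0 mul1r L1 => <-; apply: eq_bigr => j _; rewrite bin0 mulr1.
Qed.

(** The ratio is the product of the factors [(j - i) / (n - i)] for [i < k]. Each is within [i / n]
    of [j / n], and errors add up in products of numbers in [[0, 1]]. *)
Lemma bin_ratio_pow n j k : (0 < n)%N -> (j <= n)%N -> (k <= n)%N ->
  `|('C(j, k)%:R / 'C(n, k)%:R) - (j%:R / n%:R) ^+ k| <= (k * k)%:R / n%:R :> R.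
Proof.
move=> n0 jn; have n0R : 0 < n%:R :> R by rewrite ltr0n.
elim: k => [|k IHk] kn; first by rewrite !bin0 divr1 expr0 subrr normr0 mul0r.
have bn0 : 'C(n, k)%:R != 0 :> R by rewrite pnatr_eq0 -lt0n bin_gt0 ltnW.
have nk0 : (n - k)%:R != 0 :> R by rewrite pnatr_eq0 -lt0n subn_gt0.
have k0 : k.+1%:R != 0 :> R by rewrite pnatr_eq0.
have rec i : 'C(i, k.+1)%:R = (i - k)%:R * 'C(i, k)%:R / k.+1%:R :> R.
  by rewrite -natrM -mul_bin_left natrM mulrAC divff ?mul1r.
set x := j%:R / n%:R : R; set y := (j - k)%:R / (n - k)%:R : R.
set r := 'C(j, k)%:R / 'C(n, k)%:R : R.
have -> : 'C(j, k.+1)%:R / 'C(n, k.+1)%:R = r * y.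
  by rewrite !rec /r /y; field; rewrite bn0 nk0 nat1r k0.
have x01 : 0 <= x <= 1.
  by rewrite divr_ge0 ?ler0n //= ler_pdivrMr // mul1r ler_nat.
have r01 : 0 <= r <= 1.
  rewrite divr_ge0 ?ler0n //= ler_pdivrMr ?mul1r ?ler_nat ?leq_bin2l //.
  by rewrite lt0r bn0 ler0n.
have yx : `|y - x| <= k%:R / n%:R.
  have -> : `|y - x| = x - y.
    rewrite distrC ger0_norm // subr_ge0 ler_pdivrMr ?lt0r ?nk0 ?ler0n //.
    rewrite mulrAC ler_pdivlMr // -!natrM ler_nat mulnBl mulnBr leq_sub2l //.
    by rewrite mulnC leq_mul2l jn orbT.
  (* For [j <= k] the truncated subtraction gives [y = 0], while [x] is itself at most [k / n]. *)
  case: (leqP j k) => jk.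
    have -> : y = 0 by rewrite /y (eqP (_ : j - k == 0)%N) ?mul0r // subn_eq0.
    by rewrite subr0 ler_pM2r ?invr_gt0 // ler_nat.
  have -> : x - y = k%:R / n%:R * ((n - j)%:R / (n - k)%:R).
    move: nk0; rewrite /x /y !natrB ?(ltnW jk) ?(ltnW kn) // => nk0.
    by field; rewrite nk0 gt_eqF.
  rewrite ler_piMr ?divr_ge0 // ler_pdivrMr ?mul1r ?ler_nat ?leq_sub2l // 1?ltnW //.
  by rewrite lt0r nk0 ler0n.
have -> : r * y - x ^+ k.+1 = r * (y - x) + (r - x ^+ k) * x by rewrite exprSr; ring.
apply: le_trans (ler_normD _ _) _; rewrite (normrM r) (normrM _ x).
have {}IHk := IHk (ltnW kn).
apply: (@le_trans _ _ (k%:R / n%:R + (k * k)%:R / n%:R)).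
  apply: lerD.
    apply: le_trans yx; rewrite ler_piMl //.
    by case/andP: r01 => ? ?; rewrite ger0_norm.
  apply: le_trans IHk; rewrite ler_piMr //.
  by case/andP: x01 => ? ?; rewrite ger0_norm.
by rewrite -mulrDl ler_pM2r ?invr_gt0 // -natrD ler_nat; lia.
Qed.

Definition approx_quantile n (t : R) : R :=
  (quantile (bernstein_weight n) n t)%:R / n%:R.

Lemma approx_quantile_itv n t : 0 <= approx_quantile n t <= 1.
Proof.
rewrite divr_ge0 ?ler0n //= /approx_quantile.
(* For [n = 0] the quotient is 0, by the convention on inverses. *)
case: n => [|n]; first by rewrite invr0 mulr0.
by rewrite ler_pdivrMr ?ltr0n // mul1r ler_nat quantile_le.
Qed.

Lemma approx_quantile_homo n s t : s <= t ->
  approx_quantile n s <= approx_quantile n t.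
Proof. by move=> st; rewrite ler_wpM2r ?invr_ge0 // ler_nat quantile_homo. Qed.

(** The function [g j = C(j, k) / C(n, k)] has weighted mean exactly [L 'X^k]. Replacing this mean
    by a Riemann sum costs [M^-1], as [g] is monotone with total increase at most 1; replacing [g]
    by a power costs [k * k / n]. *)
Lemma approx_quantile_moment n k M : (0 < M)%N -> (0 < n)%N -> (k <= n)%N ->
  `|L 'X^k - M%:R^-1 * \sum_(i < M) approx_quantile n (i%:R / M%:R) ^+ k|
  <= M%:R^-1 + (k * k)%:R / n%:R.
Proof.
move=> M0 n0 kn; have bn0 : 0 < 'C(n, k)%:R :> R by rewrite ltr0n bin_gt0.
have M0R : 0 < M%:R :> R by rewrite ltr0n.
pose g j : R := 'C(j, k)%:R / 'C(n, k)%:R.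
have g_homo j : g j <= g j.+1 by rewrite ler_pM2r ?invr_gt0 // ler_nat leq_bin2l.
have Lg : \sum_(j < n.+1) bernstein_weight n j * g j = L 'X^k.
  under eq_bigr do rewrite mulrA.
  by rewrite -mulr_suml sum_bernstein_weight // mulrAC divff ?mul1r ?gt_eqF.
have := quantile_riemann_sum (bernstein_weight_ge0 n) (bernstein_weight_sum1 n) M0 g_homo.
rewrite Lg => h; apply: le_trans (ler_distD (M%:R^-1 *
  \sum_(i < M) g (quantile (bernstein_weight n) n (i%:R / M%:R))) _ _) (lerD _ _).
  apply: le_trans h _; rewrite -[leRHS]mul1r ler_pM2r ?invr_gt0 //.
  by rewrite /g divff ?gt_eqF // lerBlDr lerDl divr_ge0.
rewrite -mulrBr -sumrB normrM gtr0_norm ?invr_gt0 // ler_pdivrMl //.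
apply: le_trans (ler_norm_sum _ _ _) _.
rewrite [M%:R * _]mulr_natl -[X in _ <= _ *+ X]card_ord -sumr_const; apply: ler_sum => i _.
exact: bin_ratio_pow (quantile_le _ _ _) kn.
Qed.

End HausdorffApprox.

(** * The Hausdorff moment problem *)

(** Extracting a square leaves exponents 0 or 1. The mixed case uses ['X (1 - 'X) = 'X^2 (1 - 'X) +
    (1 - 'X)^2 'X]. *)
Lemma bernstein_functional_ge0 (R : realFieldType) (L : {scalar {poly R}}) :
    (forall p, 0 <= L (p ^+ 2)) -> (forall p, 0 <= L (p ^+ 2 * 'X)) ->
    (forall p, 0 <= L (p ^+ 2 * (1 - 'X))) ->
  forall i j, 0 <= L ('X^i * (1 - 'X) ^+ j).
Proof.
move=> L2 LX LY i j; pose p : {poly R} := 'X^(i./2) * (1 - 'X) ^+ j./2.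
have -> : 'X^i * (1 - 'X) ^+ j = p ^+ 2 * ('X^(odd i) * (1 - 'X) ^+ odd j) :> {poly R}.
  rewrite -{1}(odd_double_half i) -{1}(odd_double_half j) !exprD -!muln2 !exprM.
  by rewrite /p; ring.
case: (odd i); case: (odd j); rewrite ?expr0 ?expr1 ?mul1r ?mulr1 //.
have -> : p ^+ 2 * ('X * (1 - 'X)) =
    (p * 'X) ^+ 2 * (1 - 'X) + (p * (1 - 'X)) ^+ 2 * 'X by ring.
by rewrite linearD addr_ge0.
Qed.

Section HausdorffMoments.
Local Open Scope classical_set_scope.

(** An ultrafilter contains the preimage of [A] or its complement; in the second case a finer filter
    containing [A] would contain two disjoint sets. *)
Lemma fmap_ultra (S T : Type) (f : S -> T) (F : set_system S) :
  UltraFilter F -> UltraFilter (f x @[x --> F]).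
Proof.
move=> FU; split; first exact: fmap_proper_filter.
move=> G GP sFG; rewrite predeqE => A; split; last exact: sFG.
move=> GA; have [//|FnA] := in_ultra_setVsetC (f @^-1` A) FU.
have GnA : G (~` A) by exact: sFG.
by have [x []] := filter_ex (filterI GA GnA).
Qed.

(** * Limit of the quantile functions along an ultrafilter *)

Section LimitQuantile.
Variables (R : realType) (L : {scalar {poly R}}).
Hypotheses (L1 : L 1 = 1) (L_ge0 : forall i j, 0 <= L ('X^i * (1 - 'X) ^+ j)).

(** Compactness of [[0, 1]] gives a limit at every [t] along one and the same ultrafilter, with no
    selection of subsequences. The conditions are closed, and each involves finitely many values of
    [Y], so pointwise limits suffice. *)
Lemma limit_quantile : exists Y : R -> R,
  [/\ {homo Y : s t / s <= t}, forall t, 0 <= Y t <= 1 &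
      forall k M, (0 < M)%N ->
        `|L 'X^k - M%:R^-1 * \sum_(i < M) Y (i%:R / M%:R) ^+ k| <= M%:R^-1].
Proof.
have [U [UU ooU]] := ultraFilterLemma (eventually_filter).
pose y := approx_quantile L.
have cvgy t : exists l : R, y n t @[n --> U] --> l.
  have UyU : UltraFilter (y n t @[n --> U]) by exact: fmap_ultra.
  have := @segment_compact R 0 1; rewrite compact_ultra => /(_ _ UyU) [].
    by apply: nearW => n; rewrite /= in_itv /=; exact: approx_quantile_itv.
  by move=> l [_ yl]; exists l.
pose Y t := projT1 (cid (cvgy t)).
have yY t : y n t @[n --> U] --> Y t by rewrite /Y; case: cid.
exists Y; split=> [s t st|t|k M M0].
- rewrite -subr_ge0; apply: (cvgr_to_ge (cvgB (yY t) (yY s))).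
  by apply: nearW => n; rewrite subr_ge0 approx_quantile_homo.
- apply/andP; split; [apply: (cvgr_to_ge (yY t))|apply: (cvgr_to_le (yY t))];
    by apply: nearW => n; case/andP: (approx_quantile_itv L n t).
- have pow_cvg x : y n x ^+ k @[n --> U] --> Y x ^+ k.
    exact: (continuous_cvg _ (@exprn_continuous R k (Y x)) (yY x)).
  have sum_cvg : `|L 'X^k - M%:R^-1 * \sum_(i < M) y n (i%:R / M%:R) ^+ k|
      @[n --> U] --> `|L 'X^k - M%:R^-1 * \sum_(i < M) Y (i%:R / M%:R) ^+ k|.
    apply: cvg_norm; apply: cvgB; first exact: cvg_cst.
    apply: cvgMr; apply: cvg_big => [|i _]; last exact: pow_cvg.
    exact: add_continuous.
  apply/ler_addgt0Pr => e e0; apply: (cvgr_to_le sum_cvg); apply: ooU.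
  (* From [m] on, [k * k / n] is at most [e]. *)
  pose m := (Num.truncn ((k * k)%:R / e)).+1.
  near=> n; apply: le_trans (approx_quantile_moment L1 L_ge0 M0 _ _) _.
  + by near: n; exact: nbhs_infty_gt.
  + by near: n; exact: nbhs_infty_ge.
  + have n0 : (0 < n)%N by near: n; exact: nbhs_infty_gt.
    rewrite lerD2l ler_pdivrMr ?ltr0n // -ler_pdivrMl // mulrC.
    apply: le_trans (ltW (truncnS_gt _)) _; rewrite ler_nat.
    by near: n; exact: (nbhs_infty_ge m).
Unshelve. all: by end_near.
Qed.

End LimitQuantile.

(** * Riemann sums of monotone functions *)

Section MonotoneIntegral.
Variable R : realType.
Local Notation leb := (@lebesgue_measure R).
Implicit Type f : R -> R.

(** On [[x, y]] a monotone function is bounded by [|f x| + |f y|]. The interval type is left general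
    to cover half-open cells too. *)
Lemma monotone_integrable_itv f (a b : itv_bound R) (x y : R) :
    {homo f : s t / s <= t} -> [set` Interval a b] `<=` `[x, y] ->
  leb.-integrable [set` Interval a b] (EFin \o f).
Proof.
move=> f_homo abxy; apply: (@integrableS _ _ _ leb `[x, y]%classic [set` Interval a b]
  (EFin \o f)) => //.
apply: measurable_bounded_integrable => //.
- rewrite /= lebesgue_measure_itv /=; case: ifP => // _.
  by rewrite -EFinB ltry.
- exact: nondecreasing_measurable.
exists (`|f x| + `|f y|); split; first exact: num_real.
move=> r hr t /=; rewrite in_itv /= => /andP[xt ty]; apply: le_trans (ltW hr).
have := f_homo _ _ xt; have := f_homo _ _ ty.
have := ler_norm (f y); have := ler_norm (- f x); rewrite normrN.
have := normr_ge0 (f x); have := normr_ge0 (f y).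
by rewrite ler_norml => *; apply/andP; split; lra.
Qed.

(** Keeping [N] apart from [M] fixes the mesh during the induction, which adds one cell []N/M,
    (N+1)/M]] at a time. *)
Lemma monotone_riemann_bounds f M N : {homo f : s t / s <= t} -> (0 < M)%N ->
  M%:R^-1 * \sum_(i < N) f (i%:R / M%:R) <= \int[leb]_(t in `[0, N%:R / M%:R]) f t
  <= M%:R^-1 * \sum_(i < N) f (i.+1%:R / M%:R).
Proof.
move=> f_homo M0; have M0R : 0 < M%:R :> R by rewrite ltr0n.
elim: N => [|N IHN].
  by rewrite !big_ord0 mulr0 mul0r set_itv1 Rintegral_set1 lexx.
set x := N%:R / M%:R in IHN *; set y := N.+1%:R / M%:R.
have x0 : 0 <= x by rewrite divr_ge0.
have xy : x <= y by rewrite ler_pM2r ?invr_gt0 // ler_nat.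
have int01 := @monotone_integrable_itv f (BLeft 0) (BRight y) 0 y f_homo (@subset_refl _ _).
have := Rintegral_itvB int01 (x := x); rewrite !bnd_simp => /(_ x0 xy) itvB.
have sub : `]x, y] `<=` `[x, y] by apply: subset_itvr; rewrite bnd_simp.
have intxy := monotone_integrable_itv f_homo sub.
have cstP c : \int[leb]_(t in `]x, y]) c = M%:R^-1 * c.
  rewrite Rintegral_cst //= lebesgue_measure_itv /= lte_fin.
  have -> : x < y by rewrite ltr_pM2r ?invr_gt0 // ltr_nat.
  by rewrite -EFinB /= mulrC -mulrBl -natr1 addrAC subrr add0r div1r.
have icst c : leb.-integrable `]x, y] (EFin \o cst c).
  exact: (@monotone_integrable_itv (cst c) _ _ x y).
have lo : M%:R^-1 * f x <= \int[leb]_(t in `]x, y]) f t.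
  rewrite -cstP; apply: le_Rintegral => //; first exact: icst.
  by move=> t; rewrite /= in_itv /= => /andP[/ltW xt _]; exact: f_homo.
have hi : \int[leb]_(t in `]x, y]) f t <= M%:R^-1 * f y.
  rewrite -cstP; apply: le_Rintegral => //; first exact: icst.
  by move=> t; rewrite /= in_itv /= => /andP[_ ty]; exact: f_homo.
rewrite -itvB in lo hi; rewrite !big_ord_recr /= -/x -/y !mulrDr.
set I0 := \int[leb]_(t in `[0, x]) f t in IHN lo hi.
case/andP: IHN => lo0 hi0; rewrite -[X in _ <= X <= _](subrK I0) [X in _ <= X <= _]addrC.
by rewrite !lerD.
Qed.

(** The right and left endpoint sums differ by [(f 1 - f 0) / M], by telescoping. *)
Lemma monotone_riemann_sum f M : {homo f : s t / s <= t} ->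
    (forall t, 0 <= f t <= 1) -> (0 < M)%N ->
  `|\int[leb]_(t in `[0, 1]) f t - M%:R^-1 * \sum_(i < M) f (i%:R / M%:R)|
  <= M%:R^-1.
Proof.
move=> f_homo f01 M0; have M0R : 0 < M%:R :> R by rewrite ltr0n.
have := @monotone_riemann_bounds f M M f_homo M0.
rewrite divff ?gt_eqF // => /andP[lo hi]; rewrite ger0_norm ?subr_ge0 //.
apply: le_trans (lerB hi (lexx _)) _.
rewrite -mulrBr -sumrB -[leRHS]mulr1 ler_pM2l ?invr_gt0 //.
rewrite (telescope_sum_ord (fun i => f (i%:R / M%:R))) mul0r.
by have := f01 (M%:R / M%:R); have := f01 0; lra.
Qed.

End MonotoneIntegral.

(** * The representing measure *)

Section MomentMeasure.
Variables (R : realType) (L : {scalar {poly R}}).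
Hypotheses (L1 : L 1 = 1) (L_ge0 : forall i j, 0 <= L ('X^i * (1 - 'X) ^+ j)).

Local Notation unif := (uniform_prob (@ltr01 R)).

(** The measure is the law of [al * Y + be] under the uniform probability; the affine map is there
    so that a change of variable can be undone. *)
Lemma moment_measure (al be : R) :
  exists mu : {measure set (measurableTypeR R) -> \bar R}, forall p : {poly R},
    mu.-integrable [set: R] (fun x => (p.[x])%:E) /\
    (\int[mu]_(x in [set: R]) (p.[x])%:E = (L (p \Po (al *: 'X + be%:P)))%:E)%E.
Proof.
have [Y [Y_homo Y01 YL]] := limit_quantile L1 L_ge0.
have mY : measurable_fun [set: R] Y by exact: nondecreasing_measurable.
have mq (q : {poly R}) : measurable_fun [set: R] (fun x => q.[x]).
  by apply: continuous_measurable_fun; exact: continuous_horner.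
have intY k : unif.-integrable [set: R] (EFin \o (fun t => Y t ^+ k)).
  apply: measurable_bounded_integrable => //.
  - exact: le_lt_trans (probability_le1 unif measurableT) (ltry 1).
  - exact: measurable_funX.
  exists 1; split; first exact: num_real.
  move=> r r1 t _ /=; apply: le_trans (ltW r1).
  case/andP: (Y01 t) => Y0 Y1.
  by rewrite ger0_norm ?exprn_ge0 // exprn_ile1.
have YLk k : \int[unif]_t (Y t ^+ k) = L 'X^k.
  have -> : \int[unif]_t (Y t ^+ k) = \int[lebesgue_measure]_(t in `[0, 1]) (Y t ^+ k).
    rewrite /Rintegral integral_uniform.
    - by rewrite subr0 invr1 mul1e.
    - by apply/measurable_EFinP; exact: measurable_funX.
    - by move=> t; rewrite lee_fin exprn_ge0 //; case/andP: (Y01 t).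
  have Yk_homo : {homo (fun t => Y t ^+ k) : t u / t <= u}.
    by move=> t u tu; rewrite lerXn2r ?nnegrE ?Y_homo //;
      [case/andP: (Y01 t)|case/andP: (Y01 u)].
  have Yk01 t : 0 <= Y t ^+ k <= 1.
    by case/andP: (Y01 t) => Y0 Y1; rewrite exprn_ge0 ?exprn_ile1.
  apply/eqP; rewrite -subr_eq0 -normr_le0; apply/ler_addgt0Pr => e e0; rewrite add0r.
  (* Both numbers lie within [M^-1] of the same Riemann sum, and [2 / M] is at most [e]. *)
  pose M := (Num.truncn (2 / e)).+1; have M0 : (0 < M)%N by [].
  have := YL k M M0; have := monotone_riemann_sum Yk_homo Yk01 M0.
  set S := M%:R^-1 * _; rewrite [`|L _ - _|]distrC => IS SL.
  apply: le_trans (ler_distD S _ _) (le_trans (lerD IS SL) _).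
  rewrite -mulr2n -[leLHS]mulr_natl ler_pdivrMr ?ltr0n // mulrC -ler_pdivrMr //.
  exact: ltW (truncnS_gt _).
have intq N (q : nat -> R) :
    unif.-integrable [set: R] (EFin \o (fun t => \sum_(k < N) q k * Y t ^+ k)) /\
    \int[unif]_t (\sum_(k < N) q k * Y t ^+ k) = \sum_(k < N) q k * L 'X^k.
  elim: N => [|N [IHi IHN]].
    have -> : (fun t => \sum_(k < 0) q k * Y t ^+ k) = cst 0.
      by apply/funext => t; rewrite big_ord0.
    by rewrite big_ord0 Rintegral_cst // mul0r; split=> //; exact: integrable0.
  have -> : (fun t => \sum_(k < N.+1) q k * Y t ^+ k) =
      (fun t => \sum_(k < N) q k * Y t ^+ k + q N * Y t ^+ N).
    by apply/funext => t; rewrite big_ord_recr.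
  have iN : unif.-integrable [set: R] (EFin \o (fun t => q N * Y t ^+ N)).
    have -> : EFin \o (fun t => q N * Y t ^+ N) =
        (fun t => (q N)%:E * (EFin \o (fun t => Y t ^+ N)%R) t)%E.
      by apply/funext => t /=; rewrite EFinM.
    exact: integrableZl.
  split.
    have -> : EFin \o (fun t => \sum_(k < N) q k * Y t ^+ k + q N * Y t ^+ N) =
        ((EFin \o (fun t => \sum_(k < N) q k * Y t ^+ k)%R)
          \+ (EFin \o (fun t => q N * Y t ^+ N)%R))%E by [].
    exact: integrableD.
  by rewrite RintegralD // IHN RintegralZl // YLk big_ord_recr.
pose s : {poly R} := al *: 'X + be%:P.
pose Z t := al * Y t + be.
have mZ : measurable_fun [set: R] Z.
  by apply: measurable_funD => //; exact: measurable_funM.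
have ZE (p : {poly R}) : (fun x : R => (p.[x])%:E) \o Z =
    EFin \o (fun t => \sum_(k < size (p \Po s)) (p \Po s)`_k * Y t ^+ k).
  apply/funext => t /=; rewrite -horner_coef horner_comp /s.
  by rewrite hornerD hornerZ hornerX hornerC.
unshelve eexists (pushforward unif (Z : _ -> measurableTypeR R)); first exact: mZ.
move=> p.
have [pi pI] := intq (size (p \Po s)) (fun k => (p \Po s)`_k).
have mp : measurable_fun [set: R] (fun x : R => (p.[x])%:E).
  exact/measurable_EFinP.
split; first by apply: integrable_pushforward => //; rewrite ZE.
rewrite integral_pushforward //; last by rewrite ZE.
rewrite ZE; transitivity (\int[unif]_t (EFin \o
    (fun t => \sum_(k < size (p \Po s)) (p \Po s)`_k * Y t ^+ k)%R) t)%E => //.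
rewrite -(fineK (integrable_fin_num measurableT pi)).
congr EFin; apply: etrans pI _; rewrite -[in RHS](coefK (p \Po s)) poly_def.
by rewrite linear_sum /=; apply: eq_bigr => k _; rewrite linearZ.
Qed.

End MomentMeasure.

End HausdorffMoments.

(** * Favard's theorem for bounded recurrence coefficients *)

Section Favard.
Local Open Scope classical_set_scope.

Lemma bounded_favard (R : realType) (a c : nat -> R) (q : nat -> {poly R}) (K : R) :
    q 0%N = 1 -> 'X * q 0%N = a 0%N *: q 1%N ->
    (forall n, 'X * q n.+1 = a n.+1 *: q n.+2 + c n *: q n) ->
    (forall n, 0 < a n * c n) ->
    (forall n, `|a n| <= K) -> (forall n, `|c n| <= K) ->
  orthogonal_polynomials q.
Proof.
move=> q0 q1 qS ac0 aK cK.
split; first exact: size_recurrence q0 q1 qS ac0.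
pose M : {scalar {poly R}} := moment_functional ((krylov a c)^~ 0%N).
have ME p : M p = coords a c p 0 by [].
have K0 : 0 < K.
  rewrite lt_neqAle (le_trans (normr_ge0 _) (aK 0%N)) andbT.
  apply/eqP => K0; have := aK 0%N; rewrite -K0 normr_le0.
  exact/negP/jacobi_a_neq0.
pose A := 2 * K; have A0 : 0 < 2 * A by rewrite /A; lra.
(* The affine map carrying [[-A, A]] onto [[0, 1]]. *)
pose s : {poly R} := (2 * A)^-1 *: ('X + A%:P).
pose L : {scalar {poly R}} := M \o comp_poly s.
have M2 p : 0 <= M (p ^+ 2) by rewrite ME; exact: coords0_sqr_ge0 ac0 p.
have MX p := @coords0_sqrX_bound _ _ _ ac0 K p aK cK.
have L1 : L 1 = 1 by rewrite /L /= comp_polyC ME coords1.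
have L_ge0 i j : 0 <= L ('X^i * (1 - 'X) ^+ j).
  apply: bernstein_functional_ge0 => p; rewrite /L /= ?comp_polyM ?comp_polyX -?expr2.
  - exact: M2.
  - set r := p \Po s.
    have -> : r ^+ 2 * s = (2 * A)^-1 *: (A *: r ^+ 2 + r ^+ 2 * 'X).
      by rewrite /s -!mul_polyC; ring.
    rewrite linearZ linearD linearZ /= mulr_ge0 ?invr_ge0 ?(ltW A0) //.
    by have := MX r; rewrite -!ME ler_norml -/A; lra.
  - set r := p \Po s.
    have -> : r ^+ 2 * ((1 - 'X) \Po s) = (2 * A)^-1 *: (A *: r ^+ 2 - r ^+ 2 * 'X).
      have -> : (1 - 'X) \Po s = (2 * A)^-1 *: (A%:P - 'X).
        rewrite comp_polyB comp_polyX comp_polyC /s.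
        have -> : 1%:P = (2 * A)^-1 *: (2 * A)%:P.
          by rewrite scale_polyC mulVf ?gt_eqF.
        by rewrite -scalerBr mulr_natl mulr2n polyCD; congr (_ *: _); ring.
      by rewrite -!mul_polyC; ring.
    rewrite linearZ linearB linearZ /= mulr_ge0 ?invr_ge0 ?(ltW A0) //.
    by have := MX r; rewrite -!ME ler_norml -/A; lra.
(* The map [2A 'X - A] is the inverse of [s], so the composition in [L] cancels and [mu] represents
   [M]. *)
have [mu muL] := moment_measure L1 L_ge0 (2 * A) (- A).
have {}muL p : mu.-integrable [set: R] (fun x => (p.[x])%:E) /\
    (\int[mu]_(x in [set: R]) (p.[x])%:E = (M p)%:E)%E.
  have [intp ->] := muL p; split => //; congr (M _)%:E.
  rewrite /= -comp_polyA -[RHS]comp_polyXr; congr (_ \Po _).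
  rewrite comp_polyD comp_polyZ comp_polyX comp_polyC /s scalerA divff ?gt_eqF //.
  by rewrite scale1r polyCN addrK.
have orth i j : (\int[mu]_(x in [set: R]) ((q i).[x] * (q j).[x])%:E =
    (jacobi_weight a c i *+ (i == j))%:E)%E.
  under eq_integral do rewrite -hornerM.
  have [_ ->] := muL (q i * q j); rewrite ME.
  by rewrite (coords0_recurrence q0 q1 qS ac0).
exists mu; split=> [k|i j /eqP/negPf ij|i].
- have [int _] := muL 'X^k; move: int; congr (integrable _ _ _).
  by apply/funext => x; rewrite hornerXn.
- by rewrite orth ij.
- under eq_integral do rewrite expr2.
  by rewrite orth eqxx lte_fin; exact: jacobi_weight_gt0.
Qed.

End Favard.

(** * Application to the even-indexed recurrence *)

Theorem theorem5p2 (R : realType) (m : int) (P : nat -> {poly R})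
    (m_gt2 : 2 < m)
    (P0 : P 0%N = 0) (P1 : P 1%N = 0) (P2 : P 2%N = 1) (P3 : P 3%N = 0)
    (Prec : forall k : nat,
      (k%:R * m%:~R + m%:~R + 4) *: P (k + 4)%N =
        (2 * (k%:R * m%:~R - m%:~R + 2)) *: ('X * P (k + 2)%N)
        - (k%:R * m%:~R - 3 * m%:~R) *: P k) :
  orthogonal_polynomials (fun n : nat => P (2 * n + 2)%N).
Proof.
(* Integrality of [m] gives [3 <= M], which keeps [d 0] away from 0 and hence [a 0] bounded. *)
set M : R := m%:~R in Prec; have M3 : 3 <= M.
  by rewrite -[3]/(3%:~R) ler_int; move: m_gt2; lia.
pose x n : R := n%:R * M.
have x0 : x 0%N = 0 by rewrite /x mul0r.
have xS n : M <= x n.+1 by rewrite ler_peMl ?ler1n //; lra.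
have xE n : x n.+1 = x n + M by rewrite /x -natr1 mulrDl mul1r.
(* The coefficient of ['X * P (2 * n + 2)] in the recurrence at [k = 2n], where [k m = 2 * x n]. *)
pose d n : R := 2 * (2 * x n - M + 2).
have d_neq0 n : d n != 0.
  case: n => [|n]; first by rewrite /d x0 lt_eqF //; lra.
  by rewrite /d gt_eqF //; have := xS n; lra.
pose a n := (2 * x n + M + 4) / d n.
(* The coefficient of the lowest term at index [n.+1], since [2 * x n.+1 - 3 * M = 2 * x n - M]; at
   index 0 that term contains [P 0 = 0]. *)
pose c n := (2 * x n - M) / d n.+1.
have rec n : 'X * P (2 * n + 2)%N =
    a n *: P (2 * n.+1 + 2)%N + (2 * x n - 3 * M) / d n *: P (2 * n)%N.
  have := Prec (2 * n)%N; rewrite natrM -mulrA -/(x n) -/(d n).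
  have -> : (2 * n + 4 = 2 * n.+1 + 2)%N by lia.
  move=> E; apply: (scalerI (d_neq0 n)).
  rewrite scalerDr !scalerA /a ![d n * _]mulrC !divfK // E.
  by rewrite /d subrK.
(* The largest coefficient in absolute value is [|a 0| = (M + 4) / (2 (M - 2))], at most 7/2. Index
   0 is split off because [a 0] and [c 0] are negative. *)
apply: (@bounded_favard R a c _ 4) => [|||[|n]|[|n]|[|n]] /=.
- exact: P2.
- by rewrite rec muln0 P0 scaler0 addr0.
- move=> n; rewrite rec /c xE; congr (_ + _ *: _); first by congr (_ / _); ring.
  by congr (P _); lia.
- have -> : a 0%N * c 0%N = (M + 4) * M / (4 * (M - 2) * (M + 2)).
    rewrite /a /c /d xE x0; field.
    by apply/and3P; split; apply/eqP; lra.
  by apply: divr_gt0; nra.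
- have := xS n; rewrite /a /c /d !xE => ?.
  by apply: mulr_gt0; apply: divr_gt0; lra.
- rewrite /a /d x0 ler_norml; apply/andP; split.
    by rewrite ler_ndivlMr; lra.
  by rewrite ler_ndivrMr; lra.
- have := xS n => ?; rewrite /a /d ger0_norm; first by rewrite ler_pdivrMr; lra.
  by apply: divr_ge0; lra.
- rewrite /c /d xE x0 ler_norml; apply/andP; split.
    by rewrite ler_pdivlMr; lra.
  by rewrite ler_pdivrMr; lra.
- have := xS n => ?; rewrite /c /d (xE n.+1) ger0_norm; first by rewrite ler_pdivrMr; lra.
  by apply: divr_ge0; lra.
Qed.
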